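(* Let $n\ge 2$ be an integer. If $A$ is a finite weak antichain in $\mathbb{Z}^n$, then \[ |A|\le\sum_{i=1}^n|\pi_i(A)|. \]
   Context: A set $A\subseteq\mathbb{R}^n$ is a weak antichain if it does not contain two elements $\mathbf{x}=(x_1,\dots,x_n)$ and $\mathbf{y}=(y_1,\dots,y_n)$ with $x_i<y_i$ for all $i\in\{1,\dots,n\}$. For $i\in\{1,\dots,n\}$, $\pi_i:\mathbb{R}^n\to\mathbb{R}^{n-1}$ deletes the $i$-th coordinate: $\pi_i(x_1,\dots,x_n)=(x_1,\dots,x_{i-1},x_{i+1},\dots,x_n)$. $|\cdot|$ denotes cardinality. *)

(* Defs.v *)
From mathcomp Require Import all_boot all_order all_algebra.
From mathcomp Require Import finmap.

Set Implicit Arguments.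
Unset Strict Implicit.
Unset Printing Implicit Defensive.

Import Order.TTheory GRing.Theory Num.Theory.

Local Open Scope ring_scope.

(* Stated over any ordered domain so that it covers subsets of R^n as well as
   subsets of Z^n, the order on int being the restriction of the one on the
   reals. *)
Definition weak_antichain (R : realDomainType) (n : nat)
    (pT : predType 'rV[R]_n) (A : pT) : Prop :=
  ~ (exists x y : 'rV[R]_n,
       [/\ x \in A, y \in A & forall i : 'I_n, x 0 i < y 0 i]).

Definition proj (R : Type) (n : nat) (i : 'I_n) (x : 'rV[R]_n) :
  'rV[R]_n.-1 := col' i x.

(* Main.v *)
Require Import Defs.
From mathcomp Require Import all_boot all_order all_algebra.
From mathcomp Require Import finmap.

(** The sum on the right is the size of a disjoint union of the projections, so
    it is enough to choose for each point [x] of [A] a direction [i] in such a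
    way that [x] is determined by [i] and [proj i x].  Say that [y] in [A]
    witnesses level [k] at [x] if [y] is strictly above [x] in the
    coordinates [j < k] and agrees with [x] in the others.  Level [0] is
    witnessed by [x] itself, and level [n] has no witness, [A] being a weak
    antichain; hence there is an [i] such that level [i] has a witness at [x] and
    level [i.+1] has none ([exists_critical]).  That is the chosen direction.

    If two points of the same direction [i] differ in coordinate [i] only, then
    a witness of level [i] at the one with the larger [i]-th coordinate is a
    witness of level [i.+1] at the other, which is impossible
    ([proj_critical_inj]). *)

Set Implicit Arguments.
Unset Strict Implicit.

Import Order.TTheory.

Local Open Scope fset_scope.

Lemma leq_card_cover (T : choiceType) (I : finType) (A : {fset T})
    (B : I -> {fset T}) :
    (forall x, x \in A -> exists i, x \in B i) ->
  (#|` A| <= \sum_i #|` B i|)%N.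
Proof.
move=> AB; have /fsubset_leq_card/leq_trans : A `<=` \bigcup_(i <- index_enum I) B i.
  apply/fsubsetP => x /AB[i xBi]; apply/bigfcupP.
  by exists i; rewrite ?mem_index_enum.
apply; elim/big_ind2: _ => [|m X p Y mX pY|//]; first by rewrite cardfs0.
by rewrite (leq_trans _ (leq_add mX pY)) // cardfsU leq_subr.
Qed.

Lemma exists_last_step (P : pred nat) (n : nat) :
  P 0%N -> ~~ P n -> exists i : 'I_n, P i && ~~ P i.+1.
Proof.
move=> P0 PnN; apply/existsP; apply: contraNT PnN => /existsPn step.
suff PleN k : (k <= n)%N -> P k by exact: PleN.
elim: k => // k IHk lt_kn; have := step (Ordinal lt_kn).
by rewrite /= IHk ?(ltnW lt_kn) //= negbK.
Qed.

Lemma proj_eq (R : Type) (n : nat) (i j : 'I_n) (x y : 'rV[R]_n) :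
  proj i x = proj i y -> j != i -> x 0%R j = y 0%R j.
Proof.
move=> /matrixP eq_xy; case: (unliftP i j) => [k -> _|->]; last by rewrite eqxx.
by have := eq_xy 0%R k; rewrite !mxE.
Qed.

Section Witness.
Variables (R : realDomainType) (n : nat) (A : {fset 'rV[R]_n}).
Implicit Types (x y : 'rV[R]_n) (i : 'I_n).
Local Open Scope ring_scope.

Definition witness (k : nat) x y : bool :=
  [forall j : 'I_n, if (j < k)%N then x 0 j < y 0 j else x 0 j == y 0 j].

Definition witnessed (k : nat) x : bool := has (witness k x) A.

Definition critical i : {fset 'rV[R]_n} :=
  [fset x in A | witnessed i x && ~~ witnessed i.+1 x].

Lemma exists_critical x :
  weak_antichain A -> x \in A -> exists i, x \in critical i.
Proof.
move=> antiA xA; have [||i xi] := @exists_last_step (witnessed^~ x) n.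
- by apply/hasP; exists x => //; apply/forallP => j /=.
- apply/hasP => -[y yA /forallP xy]; apply: antiA; exists x, y; split=> // j.
  by have := xy j; rewrite ltn_ord.
by exists i; rewrite !inE xA.
Qed.

(** Along the line joining the two points, only coordinate [i] moves: the
    strict inequality gained there is what raises the level. *)
Lemma witnessed_step i x y :
  proj i x = proj i y -> x 0 i < y 0 i -> witnessed i y -> witnessed i.+1 x.
Proof.
move=> eq_xy lt_xy /hasP[z zA /forallP yz]; apply/hasP; exists z => //.
apply/forallP => j; have := yz j.
have [-> | neq_ji] := eqVneq j i; first by rewrite ltnn ltnSn => /eqP <-.
have -> : (j < i.+1)%N = (j < i)%N.
  by rewrite ltnS leq_eqVlt val_eqE (negPf neq_ji).
by rewrite (proj_eq eq_xy neq_ji).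
Qed.

Lemma proj_critical_inj i : {in critical i &, injective (proj i)}.
Proof.
move=> x y; rewrite !inE => /and3P[_ xi xSi] /and3P[_ yi ySi] eq_xy.
case: (ltgtP (x 0 i) (y 0 i)) => [lt_xy | lt_yx | eq_i].
- by rewrite (witnessed_step eq_xy lt_xy yi) in xSi.
- by rewrite (witnessed_step (esym eq_xy) lt_yx xi) in ySi.
apply/rowP => j; have [-> // | neq_ji] := eqVneq j i.
exact: proj_eq eq_xy neq_ji.
Qed.

Lemma card_weak_antichain_le_proj :
  weak_antichain A -> (#|` A| <= \sum_i #|` [fset proj i x | x in A]|)%N.
Proof.
move=> antiA; apply: (@leq_trans (\sum_i #|` critical i|)).
  by apply: leq_card_cover => x; apply: exists_critical.
apply: leq_sum => i _; rewrite -(card_in_imfset imfset_key (@proj_critical_inj i)).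
apply/fsubset_leq_card/fsubsetP => _ /imfsetP[x /= xi ->].
by apply/in_imfset; move: xi; rewrite !inE => /andP[].
Qed.

End Witness.

Theorem theorem1p5 (n : nat) (hn : (2 <= n)%N) (A : {fset 'rV[int]_n})
    (hA : weak_antichain A) :
  (#|` A| <= \sum_(i < n) #|` [fset proj i x | x in A]|)%N.
Proof. exact: card_weak_antichain_le_proj. Qed.
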